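(* Let $\chi$ be a finite or countable alphabet, let $\mu$ and $\nu$ be two stationary probability measures on $\chi^{\mathbb{N}}$, and let $0<\epsilon<1$. Then: (a) $\underline{\Delta}(\epsilon)\ge\epsilon\,\underline{\mathcal{R}}$ and $\overline{\Delta}(\epsilon)\le\epsilon\,\overline{\mathcal{R}}$. (b) Suppose that $\nu$ has complete grammar. Then the equalities hold in (a), i.e. $\underline{\Delta}(\epsilon)=\epsilon\,\underline{\mathcal{R}}$ and $\overline{\Delta}(\epsilon)=\epsilon\,\overline{\mathcal{R}}$.
   Context: Sequences in $\chi^{\mathbb{N}}$ are written $\mathbf{x}=(x_0,x_1,\dots)$, $\sigma$ is the left shift on $\chi^{\mathbb{N}}$, i.e. $\sigma\mathbf{x}=(x_1,x_2,\dots)$, and $x_m^n=x_mx_{m+1}\cdots x_n$. A string $\omega\in\chi^n$ is identified with the cylinder of sequences $\mathbf{z}\in\chi^{\mathbb{N}}$ with $z_0^{n-1}=\omega$; $\mu\nu(\omega)=\mu(\omega)\nu(\omega)$. Stationary means $\sigma$-invariant, and $\mathbb{P}=\mu\times\nu$ is the product measure, the law of the pair $(\mathbf{x},\mathbf{y})$. The measure $\nu$ has complete grammar if $\nu(\omega)>0$ for all $n$ and all $\omega\in\chi^n$. Shortest-path function: $T_n^{(2)}(\mathbf{x},\mathbf{y})=\inf\{k\ge 1: y_0^{n-1}\cap\sigma^{-k}(x_0^{n-1})\ne\emptyset\}$. $k$-divergence: $\mathbb{E}_{\mu,\nu}(k)=\sum_{\omega\in\chi^k}\mu\nu(\omega)$.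 Limiting rates: $$\underline{\mathcal{R}}=\liminf_{k\to\infty}\left(-\frac1k\log\mathbb{E}_{\mu,\nu}(k)\right),\qquad \overline{\mathcal{R}}=\limsup_{k\to\infty}\left(-\frac1k\log\mathbb{E}_{\mu,\nu}(k)\right).$$ Lower deviation rates: $$\underline{\Delta}(\epsilon)=\liminf_{n\to\infty}\frac1n\left|\log\mathbb{P}\left(\frac{T_n^{(2)}}{n}<1-\epsilon\right)\right|,\qquad \overline{\Delta}(\epsilon)=\limsup_{n\to\infty}\frac1n\left|\log\mathbb{P}\left(\frac{T_n^{(2)}}{n}<1-\epsilon\right)\right|.$$ Logarithms may be taken in any (common) base, and $-\log 0=|\log 0|=+\infty$. *)

(* Defs.v *)
From HB Require Import structures.
From mathcomp Require Import all_boot all_order all_algebra.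
From mathcomp Require Import all_classical all_reals all_analysis.

Set Implicit Arguments.
Unset Strict Implicit.
Unset Printing Implicit Defensive.

Import Order.TTheory GRing.Theory Num.Theory.
Import numFieldNormedType.Exports.

Local Open Scope classical_set_scope.
Local Open Scope ring_scope.
Local Open Scope ereal_scope.

(* The alphabet is a [pointedType]: it is nonempty as soon as its sequence
   space carries a probability measure, and [g_sigma_algebraType] is only
   measurable over a pointed type. *)
Section sequence_space.
Variable chi : pointedType.

Definition shift (x : nat -> chi) : nat -> chi := fun i => x i.+1.

Definition initial_word (n : nat) (x : nat -> chi) : n.-tuple chi :=
  [tuple x i | i < n].

Definition cylinder (n : nat) (w : n.-tuple chi) : set (nat -> chi) :=
  [set z | initial_word n z = w].

Definition cylinders : set (set (nat -> chi)) :=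
  [set A | exists (n : nat) (w : n.-tuple chi), A = cylinder w].

End sequence_space.

(* For a countable alphabet the cylinders generate the product of the discrete
   sigma-algebras. *)
Notation seqspace chi := (g_sigma_algebraType (@cylinders chi)).

Definition stationary (R : realType) (chi : pointedType)
    (mu : probability (seqspace chi) R) : Prop :=
  forall A : set (seqspace chi), measurable A -> mu (@shift chi @^-1` A) = mu A.

Definition complete_grammar (R : realType) (chi : pointedType)
    (nu : probability (seqspace chi) R) : Prop :=
  forall (n : nat) (w : n.-tuple chi), 0 < nu (cylinder w).

(* T_n^(2), with values in the extended reals (inf of the empty set is +oo). *)
Definition shortest_path (R : realType) (chi : pointedType) (n : nat)
    (x y : nat -> chi) : \bar R :=
  ereal_inf [set (k%:R)%:E | k in [set k : nat | (1 <= k)%N /\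
    cylinder (initial_word n y) `&`
      (iter k (@shift chi) @^-1` cylinder (initial_word n x)) !=set0]].

Section rates.
Variables (R : realType) (chi : pointedType).
Variables mu nu : probability (seqspace chi) R.

Definition divergence (k : nat) : \bar R :=
  \esum_(w in [set: k.-tuple chi]) (mu (cylinder w) * nu (cylinder w)).

(* [lne 0 = -oo], so that the rate is +oo where the divergence vanishes;
   the (meaningless) term of index 0 does not affect the limits. *)
Definition divergence_rate (k : nat) : \bar R :=
  (k%:R^-1)%:E * - lne (divergence k).

Definition lower_rate : \bar R := limn_einf divergence_rate.

Definition upper_rate : \bar R := limn_esup divergence_rate.

Definition lower_deviation_event (eps : R) (n : nat) :
    set (seqspace chi * seqspace chi) :=
  [set xy | shortest_path R n xy.1 xy.2 * (n%:R^-1)%:E < (1 - eps)%:E].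

Definition deviation_rate (eps : R) (n : nat) : \bar R :=
  (n%:R^-1)%:E * `|lne ((mu \x nu) (lower_deviation_event eps n))|.

Definition lower_Delta (eps : R) : \bar R := limn_einf (deviation_rate eps).

Definition upper_Delta (eps : R) : \bar R := limn_esup (deviation_rate eps).

End rates.

(* Main.v *)
(* For k < n, the cylinder of y_0^{n-1} meets sigma^{-k}(x_0^{n-1}) exactly when
   y_k^{n-1} = x_0^{n-k-1}, an event of probability E(n-k) by stationarity of nu.
   With m the least integer > n eps, the event T_n < (1 - eps) n is the union of
   these events over 1 <= k <= n - m; it contains the one with k = n - m, and each
   of them forces a match of length m.  Hence E(m) <= P(T_n < (1 - eps) n) <= n E(m)
   for large n, where m / n tends to eps and m runs through all positive integers.
   Since log n / n tends to 0, both inequalities of (a) are equalities. *)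
Require Import Defs.
From HB Require Import structures.
From mathcomp Require Import all_boot all_order all_algebra.
From mathcomp Require Import all_classical all_reals all_analysis.
From mathcomp Require Import ring lra.

Set Implicit Arguments.
Unset Strict Implicit.
Unset Printing Implicit Defensive.

Import Order.TTheory GRing.Theory Num.Theory.
Import numFieldNormedType.Exports.
Local Open Scope classical_set_scope.
Local Open Scope ring_scope.
Local Open Scope ereal_scope.

(** * Countable additivity over countable index types *)

Lemma measure_countable_bigcup (d : measure_display) (T : measurableType d)
    (R : realType) (m : {measure set T -> \bar R}) (U : choiceType)
    (F : U -> set T) :
  countable [set: U] -> (forall u, measurable (F u)) -> trivIset setT F ->
  m (\bigcup_u F u) = \esum_(u in [set: U]) m (F u).
Proof.
move=> /countable_injP[g ginj] mF tF.
(* The injection [g] sorts the family by code: each fibre [J n] is empty or a singleton, so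
   sigma-additivity for the sequence [G] applies. *)
pose J n := g @^-1` [set n]; pose G n := \bigcup_(u in J n) F u.
have JF u : J (g u) = [set u].
  by apply/seteqP; split => [v /= guv|v ->//]; apply: ginj; rewrite ?inE.
have GE n : measurable (G n) /\ m (G n) = \esum_(u in J n) m (F u).
  have [[u _ <-]|Jn0] := pselect (range g n).
    by rewrite /G JF bigcup_set1 esum_set1.
  have J0 : J n = set0.
    by apply/eqP/negPn/negP => /set0P[u gu]; apply: Jn0; exists u.
  by rewrite /G J0 bigcup_set0 esum_set0 measure0.
have UG : \bigcup_u F u = \bigcup_n G n.
  apply/seteqP; split => [x [u _ Fu]|x [n _ [u _ Fu]]]; last by exists u.
  by exists (g u) => //; exists u.
have tG : trivIset setT G.
  apply/trivIsetP => i j _ _ ij; apply/eqP/negPn/negP => /set0P[x].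
  case=> -[u /= gu Fu] [v /= gv Fv]; move: ij; rewrite -gu -gv.
  by rewrite (tF u v I I) ?eqxx//; exists x.
have mG n : measurable (G n) by case: (GE n).
rewrite UG measure_semi_bigcup//; last exact: bigcup_measurable.
under eq_eseriesr do rewrite (GE _).2.
rewrite -nneseries_sum_bigcup//.
- congr (esum _ _); apply/seteqP; split => // u _.
  by exists (g u).
- apply/trivIsetP => i j _ _ ij; apply/eqP/negPn/negP.
  by move=> /set0P[u [/= gi gj]]; move: ij; rewrite -gi -gj eqxx.
Qed.

Lemma countable_tuple (T : choiceType) (n : nat) :
  countable [set: T] -> countable [set: n.-tuple T].
Proof.
move=> /countable_injP[g ginj]; apply/countable_injP.
exists (fun t : n.-tuple T => pickle (map g t)) => s t _ _.
move=> /(pcan_inj pickleK) st; apply: val_inj.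
by apply: inj_map st => x y xy; apply: ginj; rewrite ?inE.
Qed.

(** * Matches between a prefix of x and a block of y *)

Section coincidences.
Variable chi : pointedType.
Hypothesis chi_countable : countable [set: chi].

Lemma measurable_cylinder (n : nat) (w : n.-tuple chi) :
  measurable (cylinder w : set (seqspace chi)).
Proof. by apply: sub_gen_smallest; exists n, w. Qed.

Lemma measurable_shift :
  measurable_fun setT (@Defs.shift chi : seqspace chi -> seqspace chi).
Proof.
apply: (@measurability _ _ (seqspace chi) (seqspace chi) setT (@Defs.shift chi)
  (@cylinders chi)) => // _ [_ [n [w ->]] <-].
(* The preimage of a cylinder leaves the first letter free; the union over that letter is measurable
   because the alphabet is countable. *)
rewrite setTI (_ : _ @^-1` _ = \bigcup_(a : chi) cylinder [tuple of a :: w]).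
  by apply: countable_bigcupT_measurable => // a; exact: measurable_cylinder.
have initial_wordS (x : nat -> chi) :
    initial_word n.+1 x = [tuple of x 0%N :: initial_word n (Defs.shift x)].
  by apply: eq_from_tnth => i; case: (unliftP ord0 i) => [j|] ->;
    rewrite ?tnthS ?tnth0 !tnth_mktuple.
apply/seteqP; split => x /=.
  by move=> <-; exists (x 0%N) => //; rewrite /cylinder/= initial_wordS.
move=> [a _]; rewrite /cylinder/= initial_wordS => /(congr1 val)/= [_ xw].
exact: val_inj.
Qed.

Lemma measurable_iter_shift (k : nat) (A : set (seqspace chi)) :
  measurable A ->
  measurable (iter k (@Defs.shift chi) @^-1` A : set (seqspace chi)).
Proof.
elim: k A => [//|k IH] A mA.
rewrite (_ : _ @^-1` _ = iter k (@Defs.shift chi) @^-1` (@Defs.shift chi @^-1` A))//.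
by apply: IH; rewrite -[_ @^-1` _]setTI; exact: measurable_shift.
Qed.

(** The shift acts on the second sequence, so that stationarity of [nu] makes the probability
    independent of [k]. *)
Definition coincidence (n k : nat) :
    set (seqspace chi * seqspace chi) :=
  [set xy | initial_word n xy.1 = initial_word n (iter k (@Defs.shift chi) xy.2)].

Lemma coincidenceE n k : coincidence n k =
  \bigcup_(w : n.-tuple chi)
    (cylinder w `*` iter k (@Defs.shift chi) @^-1` cylinder w).
Proof.
apply/seteqP; split => [[x y] xy|[x y] [w _ [/= xw yw]]].
  by exists (initial_word n (iter k (@Defs.shift chi) y)).
exact: etrans xw (esym yw).
Qed.

Lemma measurable_coincidence n k : measurable (coincidence n k).
Proof.
rewrite coincidenceE; apply: countable_bigcupT_measurable.
  exact: countable_tuple.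
move=> w; apply: measurableX; first exact: measurable_cylinder.
by apply: measurable_iter_shift; exact: measurable_cylinder.
Qed.

Variables (R : realType) (mu nu : probability (seqspace chi) R).
Hypothesis nu_stationary : stationary nu.

Lemma stationary_iter (k : nat) (A : set (seqspace chi)) :
  measurable A -> nu (iter k (@Defs.shift chi) @^-1` A) = nu A.
Proof.
elim: k A => [//|k IH] A mA.
rewrite (_ : _ @^-1` _ = iter k (@Defs.shift chi) @^-1` (@Defs.shift chi @^-1` A))//.
rewrite IH ?nu_stationary//.
by rewrite -[_ @^-1` _]setTI; exact: measurable_shift.
Qed.

(** The event is a disjoint union of rectangles indexed by the common word, and stationarity of [nu]
    removes the shift from each second side. *)
Lemma product_coincidence n k :
  (mu \x nu) (coincidence n k) = divergence mu nu n.
Proof.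
rewrite coincidenceE measure_countable_bigcup.
- apply: eq_esum => w _; have mw := @measurable_cylinder n w.
  rewrite -(stationary_iter k mw).
  by apply: product_measure1E => //; exact: measurable_iter_shift.
- exact: countable_tuple.
- move=> w; apply: measurableX; first exact: measurable_cylinder.
  by apply: measurable_iter_shift; exact: measurable_cylinder.
- by move=> v w _ _ [[x y] [[/= <- _] [/= <- _]]].
Qed.

Lemma divergence_le1 n : divergence mu nu n <= 1.
Proof.
by rewrite -(product_coincidence n 0) probability_le1//;
  exact: measurable_coincidence.
Qed.

Lemma divergence_ge0 n : 0 <= divergence mu nu n.
Proof. by rewrite -(product_coincidence n 0). Qed.

End coincidences.

(** * The deviation event as a union of matches *)

Section lower_deviation.
Variable chi : pointedType.
Hypothesis chi_countable : countable [set: chi].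

Lemma iter_shiftE k (x : nat -> chi) i :
  iter k (@Defs.shift chi) x i = x (k + i)%N.
Proof. by elim: k i => // k IH i; rewrite iterS /Defs.shift IH addnS. Qed.

Lemma initial_wordP n (x y : nat -> chi) :
  initial_word n x = initial_word n y <-> forall i, (i < n)%N -> x i = y i.
Proof.
split=> [xy i ni|xy].
  by have := congr1 (fun t => tnth t (Ordinal ni)) xy; rewrite !tnth_mktuple.
by apply: eq_from_tnth => i; rewrite !tnth_mktuple xy.
Qed.

(** A common point must follow y on places below n and x on places k to k + n - 1; these demands
    overlap on k <= j < n only. For k >= n nothing overlaps, and truncated subtraction gives the
    trivial match of length 0. *)
Lemma cylinder_meet_shift n k (x y : nat -> chi) :
  cylinder (initial_word n y) `&`
    (iter k (@Defs.shift chi) @^-1` cylinder (initial_word n x)) !=set0 <->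
  coincidence (n - k) k (x, y).
Proof.
split=> [[z [/initial_wordP zy /initial_wordP zx]]|/initial_wordP xy].
  apply/initial_wordP => i; rewrite ltn_subRL => ikn /=.
  by rewrite -zx ?iter_shiftE ?zy// (leq_ltn_trans (leq_addl k i)).
(* Glue y to x moved by k. If n < k, places n to k - 1 are unconstrained, so the truncated [j - k]
   is harmless there. *)
exists (fun j => if (j < n)%N then y j else x (j - k)%N); split.
  by apply/initial_wordP => i ->.
apply/initial_wordP => i ni; rewrite iter_shiftE addKn; case: ifPn => // kin.
by have := xy i; rewrite /= ltn_subRL kin iter_shiftE => ->.
Qed.

Variables (R : realType) (eps : R).
Hypotheses (eps_gt0 : (0 < eps)%R) (eps_lt1 : (eps < 1)%R).

(* The shortest match forced by T_n < (1 - eps) n. *)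
Definition match_length (n : nat) : nat := (Num.truncn (n%:R * eps)).+1.

Lemma match_length_bounds n :
  (n%:R * eps < (match_length n)%:R <= n%:R * eps + 1)%R.
Proof.
have /truncn_itv/andP[le lt] : (0 <= n%:R * eps)%R by rewrite mulr_ge0// ltW.
by rewrite lt /match_length -natr1 lerD2r.
Qed.

(** The left side says n eps < n - k, that is, the integer n - k exceeds the floor of n eps; hence
    the successor in [match_length]. *)
Lemma match_lengthP n k :
  (k%:R < (1 - eps) * n%:R)%R = (k + match_length n <= n)%N.
Proof.
have n0 : (0 <= n%:R * eps)%R by rewrite mulr_ge0// ltW.
rewrite /match_length addnS mulrBl mul1r (mulrC eps) ltrBrDr addrC -ltrBrDr.
have [kn|nk] := leqP k n; first by rewrite -natrB// -truncn_lt_nat// ltn_subRL.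
(* For k > n both sides are false. *)
rewrite ltnNge (leq_trans (ltnW nk)) ?leq_addr//; apply/negbTE.
by rewrite -leNgt (le_trans _ n0)// subr_le0 ler_nat ltnW.
Qed.

(** The infimum is below the bound exactly when some admissible shift is. At n = 0 the inverse is 0
    by convention, so the event would be the whole space while the union is empty. *)
Lemma lower_deviation_eventE n : (0 < n)%N ->
  lower_deviation_event eps n =
  \bigcup_(k in [set k | (0 < k)%N /\ (k + match_length n <= n)%N])
    coincidence (chi := chi) (n - k) k.
Proof.
move=> n0; have n0R : (0 < n%:R :> R)%R by rewrite ltr0n.
apply/seteqP; split => [[x y]|[x y] [k [k0 kn] xy]];
  rewrite /lower_deviation_event /shortest_path/= lte_pdivrMr// -EFinM.
  move=> /ereal_inf_ltP[_ [k [k0 /cylinder_meet_shift xy] <-]].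
  by rewrite lte_fin match_lengthP => kn; exists k.
apply/ereal_inf_ltP; exists k%:R%:E; last by rewrite lte_fin match_lengthP.
by exists k => //; split => //; exact/cylinder_meet_shift.
Qed.

Lemma measurable_lower_deviation_event n : (0 < n)%N ->
  measurable (lower_deviation_event eps n : set (seqspace chi * seqspace chi)).
Proof.
move=> n0; rewrite lower_deviation_eventE//; apply: bigcup_measurable => k _.
exact: measurable_coincidence.
Qed.

Variables mu nu : probability (seqspace chi) R.
Hypothesis nu_stationary : stationary nu.

(** The largest admissible shift, [n - match_length n], leaves a match of exactly the required
    length; the hypothesis makes this shift positive. *)
Lemma divergence_le_product n : (match_length n < n)%N ->
  divergence mu nu (match_length n) <= (mu \x nu) (lower_deviation_event eps n).
Proof.
move=> mn; have n0 : (0 < n)%N by apply: leq_ltn_trans mn.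
rewrite -(product_coincidence chi_countable mu nu_stationary _
  (n - match_length n)).
apply: le_measure; rewrite ?inE.
- exact: measurable_coincidence.
- exact: measurable_lower_deviation_event.
- rewrite lower_deviation_eventE// => xy xyP; exists (n - match_length n)%N => /=.
    by rewrite subn_gt0 subnK// ltnW.
  by rewrite subKn// ltnW.
Qed.

(** Union bound over all shifts below n, each match being truncated to its prefix of length
    [match_length n]. *)
Lemma product_le_divergence n : (0 < n)%N ->
  (mu \x nu) (lower_deviation_event eps n) <=
  n%:R%:E * divergence mu nu (match_length n).
Proof.
move=> n0.
have -> : n%:R%:E * divergence mu nu (match_length n) =
    \sum_(k < n) (mu \x nu) (coincidence (match_length n) k).
  under eq_bigr do rewrite product_coincidence//.
  by rewrite sumr_const card_ord mule_natl.
apply: content_subadditive.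
- by move=> k _; exact: measurable_coincidence.
- exact: measurable_lower_deviation_event.
- rewrite lower_deviation_eventE// -bigcup_mkord => -[x y] [k [k0 kn] /= xy].
  exists k => /=; first by rewrite (leq_trans _ kn)// /match_length addnS leq_addr.
  apply/initial_wordP => i im; move/initial_wordP : xy; apply.
  by rewrite (leq_trans im)// leq_subRL// (leq_trans (leq_addr _ _) kn).
Qed.

End lower_deviation.

(** * Limits inferior and superior in the extended reals *)

Section limits.
Variable R : realType.
Implicit Types (u v : (\bar R)^nat) (r : R).

(** This form involves only eventual inequalities. A set of the filter yields its supremum as an
    eventual bound; a bound x yields the set where [u n <= x]. *)
Lemma limn_esupE u :
  limn_esup u = ereal_inf [set x | \forall n \near \oo, u n <= x].
Proof.
rewrite /limn_esup limf_esupE; apply/eqP; rewrite eq_le; apply/andP; split.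
  apply: le_ereal_inf_tmp => x ux.
  apply: (@le_trans _ _ (ereal_sup [set u n | n in [set n | u n <= x]])).
    by apply: ereal_inf_lbound; exists [set n | u n <= x].
  by apply: ge_ereal_sup => _ [n unx <-].
apply: le_ereal_inf_tmp => _ [V nV <-]; apply: ereal_inf_lbound => /=.
by apply: filterS nV => n Vn; apply: ereal_sup_ubound; exists n.
Qed.

Lemma limn_einfE u :
  limn_einf u = ereal_sup [set x | \forall n \near \oo, x <= u n].
Proof.
rewrite /limn_einf limn_esupE ereal_infEN oppeK; congr ereal_sup.
apply/seteqP; split => [_ [x ux <-]|x ux] /=.
  by near do rewrite leeNl; exact: ux.
by exists (- x); rewrite ?oppeK//=; near do rewrite leeN2; exact: ux.
Unshelve. all: by end_near. Qed.

(** One hypothesis per direction: [m] eventually enters every tail, and every large value is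
    attained by [m] within any prescribed tail. Hence reindexing by [m] preserves limits inferior
    and superior exactly. *)
Lemma near_subsequence (m : nat -> nat) (P : nat -> Prop) :
  (forall N, \forall n \near \oo, (N <= m n)%N) ->
  (forall N, \forall k \near \oo, exists2 n, (N <= n)%N & m n = k) ->
  (\forall n \near \oo, P (m n)) <-> (\forall n \near \oo, P n).
Proof.
move=> m_oo m_surj; split=> [[N _ NP]|[N _ NP]].
  by apply: filterS (m_surj N) => _ [n Nn <-]; exact: NP.
by apply: filterS (m_oo N) => n; exact: NP.
Qed.

Lemma limn_esup_subsequence u (m : nat -> nat) :
  (forall N, \forall n \near \oo, (N <= m n)%N) ->
  (forall N, \forall k \near \oo, exists2 n, (N <= n)%N & m n = k) ->
  limn_esup (u \o m) = limn_esup u.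
Proof.
move=> m_oo m_surj; rewrite !limn_esupE; congr ereal_inf.
by apply/seteqP; split => x /=;
  apply (@near_subsequence m (fun n => u n <= x)).
Qed.

Lemma limn_einf_subsequence u (m : nat -> nat) :
  (forall N, \forall n \near \oo, (N <= m n)%N) ->
  (forall N, \forall k \near \oo, exists2 n, (N <= n)%N & m n = k) ->
  limn_einf (u \o m) = limn_einf u.
Proof.
by move=> m_oo m_surj; congr (- _); exact: (@limn_esup_subsequence (\- u)).
Qed.

Lemma limn_esupZ u r : (0 < r)%R ->
  limn_esup (fun n => r%:E * u n) = r%:E * limn_esup u.
Proof.
move=> r0; rewrite !limn_esupE -ereal_inf_pZl//; congr ereal_inf.
have rrV x : r%:E * (r^-1%:E * x) = x by rewrite muleA -EFinM divff ?gt_eqF// mul1e.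
apply/seteqP; split => [x ux|_ [x ux <-]] /=.
  exists (r^-1%:E * x) => //=; near do rewrite -(@lee_pmul2l _ r%:E)// rrV; exact: ux.
by near do rewrite lee_pmul2l//; exact: ux.
Unshelve. all: by end_near. Qed.

Lemma limn_einfZ u r : (0 < r)%R ->
  limn_einf (fun n => r%:E * u n) = r%:E * limn_einf u.
Proof.
move=> r0; rewrite /limn_einf muleN -limn_esupZ//; congr (- limn_esup _).
by apply/funext => n; rewrite muleN.
Qed.

(** An eventual real bound x of [v] gives the bound (1 + r) x + r of [u], for every r > 0.
    Nonnegativity of [v] excludes x = -oo. *)
Lemma limn_esup_perturb u v : (forall n, 0 <= v n) ->
  (forall r, (0 < r)%R -> \forall n \near \oo, u n <= (1 + r)%:E * v n + r%:E) ->
  limn_esup u <= limn_esup v.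
Proof.
move=> v0 uv; rewrite [leRHS]limn_esupE; apply: le_ereal_inf_tmp => x vx.
have : 0 <= x by have [n] := filter_ex vx; exact: le_trans.
case: x vx => [x| |//] vx; last by move=> _; exact: leey.
rewrite lee_fin => x0; apply/lee_addgt0Pr => d d0.
have x1 : (0 < x + 1)%R by rewrite ltr_wpDl.
(* With this r, (1 + r) x + r is exactly x + d. *)
have e0 : (0 < d / (x + 1))%R by rewrite divr_gt0.
rewrite limn_esupE; apply: ereal_inf_lbound => /=.
apply: filterS2 vx (uv _ e0) => n vnx /le_trans; apply.
rewrite (@le_trans _ _ ((1 + d / (x + 1))%:E * x%:E + (d / (x + 1))%:E))//.
  by rewrite leeD2r// lee_pmul2l// lte_fin addr_gt0.
by rewrite -EFinM -!EFinD lee_fin le_eqVlt; apply/orP; left; apply/eqP; field;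
  rewrite gt_eqF.
Qed.

Lemma limn_einf_perturb u v : (forall n, 0 <= v n) ->
  (forall r, (0 < r)%R -> \forall n \near \oo, u n <= (1 + r)%:E * v n + r%:E) ->
  limn_einf u <= limn_einf v.
Proof.
move=> v0 uv; rewrite [leLHS]limn_einfE; apply: ge_ereal_sup => -[x| |//] ux /=.
- apply/lee_addgt0Pr => d d0; rewrite -leeBlDr// limn_einfE.
  apply: ereal_sup_ubound => /=.
  (* Here x may be negative, hence the absolute value. Only a value t < x of [v n] needs work, and
     then r (t + 1) <= r (|x| + 1) = d. *)
  have x1 : (0 < `|x| + 1)%R by rewrite ltr_wpDl.
  have e0 : (0 < d / (`|x| + 1))%R by rewrite divr_gt0.
  apply: filterS2 ux (uv _ e0) => n xu /(le_trans xu).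
  case: (v n) (v0 n) => [t| |//]; last by move=> _ _; exact: leey.
  rewrite lee_fin -EFinM -!EFinD !lee_fin => t0 xt.
  have [tx|xt'] := ltP t x; last by rewrite lerBlDr (le_trans xt')// lerDl ltW.
  rewrite lerBlDr (le_trans xt)//.
  have := ler_wpM2l (ltW e0) (le_trans (ltW tx) (ler_norm x)).
  have := divfK (lt0r_neq0 x1) d; lra.
(* For x = +oo, take r = 1: 2 v n + 1 is +oo only if [v n] is. *)
- rewrite limn_einfE; apply: ereal_sup_ubound => /=.
  apply: filterS2 ux (uv _ ltr01) => n xu /(le_trans xu).
  by case: (v n) (v0 n) => [t| |]; rewrite ?leexx// -EFinM -EFinD leye_eq.
- by rewrite leNye.
Qed.

(** The square of exp(nr/2) is at least that of nr/2, which is at least n once n >= 4/r^2. *)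
Lemma ln_sublinear_near r : (0 < r)%R ->
  \forall n \near \oo, (ln n%:R <= n%:R * r)%R.
Proof.
move=> r0; near=> n.
have n0 : (0 < n%:R :> R)%R by rewrite ltr0n; near: n; exact: nbhs_infty_gt.
have nr : (4 / r ^+ 2 <= n%:R)%R by near: n; exact: nbhs_infty_ger.
rewrite -ler_expR lnK ?posrE//.
have -> : (n%:R * r = n%:R * r / 2 + n%:R * r / 2)%R by rewrite -splitr.
rewrite expRD -expr2.
apply: (@le_trans _ _ ((n%:R * r / 2) ^+ 2)%R).
  rewrite -[leLHS]mulr1 expr2 -!mulrA ler_pM2l//.
  move: nr; rewrite ler_pdivrMr ?exprn_gt0// => nr.
  by lra.
rewrite ler_pXn2r// ?nnegrE ?expR_ge0//.
  by apply: le_trans (expR_ge1Dx _); rewrite lerDr.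
by rewrite divr_ge0// mulr_ge0// ltW.
Unshelve. all: by end_near. Qed.

End limits.

(** * Growth of the match length *)

Section match_length_limits.
Variables (R : realType) (eps : R).
Hypotheses (eps_gt0 : (0 < eps)%R) (eps_lt1 : (eps < 1)%R).

Lemma match_length_infty N : \forall n \near \oo, (N <= match_length eps n)%N.
Proof.
near=> n; rewrite -(ler_nat R); have /andP[/ltW + _] := match_length_bounds eps_gt0 n.
by apply: le_trans; rewrite -ler_pdivrMr//; near: n; exact: nbhs_infty_ger.
Unshelve. all: by end_near. Qed.

(** As eps < 1, the floor of n eps skips no integer. For k = j + 1 let n be the floor of j/eps: then
    j < (n + 1) eps < j + 1, so n + 1 is the witness. *)
Lemma match_length_surj N :
  \forall k \near \oo, exists2 n, (N <= n)%N & match_length eps n = k.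
Proof.
exists N.+1 => // -[//|j] /= Nj.
have j0 : (0 <= j%:R / eps)%R by rewrite divr_ge0// ltW.
have /andP[lo hi] := truncn_itv j0; set n := Num.truncn _ in lo hi.
have {}lo : (n%:R * eps <= j%:R)%R by rewrite -ler_pdivlMr.
have {}hi : (j%:R < n.+1%:R * eps)%R by rewrite -ltr_pdivrMr.
exists n.+1.
  rewrite (leq_trans (Nj : (N <= j)%N))// ltnW// -(ltr_nat R) (lt_le_trans hi)//.
  by rewrite ler_piMr// ltW.
congr _.+1; apply: truncn_def; rewrite ltW//=.
by rewrite -!natr1 mulrDl mul1r ler_ltD.
Qed.

Lemma match_length_near_lt : \forall n \near \oo, (match_length eps n < n)%N.
Proof.
near=> n; rewrite -(ltr_nat R).
have /andP[_ /le_lt_trans] := match_length_bounds eps_gt0 n; apply.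
rewrite -ltrBrDl -{1}[n%:R]mulr1 -mulrBr -ltr_pdivrMr ?subr_gt0//.
by near: n; exact: nbhs_infty_gtr.
Unshelve. all: by end_near. Qed.

End match_length_limits.

(** Logarithms turn a <= p <= n a into -ln p <= -ln a <= ln n - ln p, and the bounds on m give eps/m
    < 1/n <= (1 + 1/(n eps)) eps/m. *)
Lemma log_rate_bounds (R : realType) (eps : R) (a p : \bar R) (n m : nat) :
  (0 < eps)%R -> (0 < n)%N -> (n%:R * eps < m%:R <= n%:R * eps + 1)%R ->
  0 <= a -> a <= p -> p <= n%:R%:E * a -> p <= 1 ->
  (n%:R^-1)%:E * `|lne p| <=
    (1 + (n%:R * eps)^-1)%:E * (eps%:E * ((m%:R^-1)%:E * - lne a)) /\
  eps%:E * ((m%:R^-1)%:E * - lne a) <=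
    (n%:R^-1)%:E * `|lne p| + (ln n%:R / n%:R)%:E.
Proof.
move=> eps_gt0 n_gt0 m_bounds a_ge0 ap pna p_le1.
have n0 : (0 < n%:R :> R)%R by rewrite ltr0n.
have [ne_m m_ne] := andP m_bounds.
have ne0 : (0 < n%:R * eps)%R by rewrite mulr_gt0.
have m0 : (0 < m%:R :> R)%R by exact: lt_trans ne_m.
(* If a = 0 then p = 0, and both sides of each inequality are +oo. *)
have [a0|a0] := eqVneq a 0.
  have -> : p = 0 by apply/eqP; rewrite eq_le {1}(le_trans pna) ?a0 ?mule0// -a0.
  rewrite a0 le0_lneNy//= !gt0_muley ?lte_fin ?invr_gt0// ?addye ?leexx//.
  by rewrite addr_gt0// invr_gt0.
have {}a0 : 0 < a by rewrite lt0e a0.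
have p0 : 0 < p by exact: lt_le_trans ap.
case: p p_le1 p0 ap pna => // {}p; rewrite !lee_fin lte_fin => p_le1' p0.
case: a a_ge0 a0 => [{}a| |] _ //; rewrite lte_fin => a0.
rewrite -!EFinM !lee_fin => ap' pna'.
rewrite !lne_EFin//= -?EFinN -?EFinM -?EFinD !lee_fin ler0_norm ?ln_le0//.
have lnap : (ln a <= ln p)%R by rewrite ler_ln ?posrE.
have lnpa : (ln p <= ln n%:R + ln a)%R by rewrite -lnM ?posrE// ler_ln ?posrE// mulr_gt0.
have lna0 : (ln a <= 0)%R by rewrite (le_trans lnap)// ln_le0.
split.
  have -> : ((1 + (n%:R * eps)^-1) * (eps * (m%:R^-1 * - ln a)) =
    (n%:R^-1 * - ln a) * ((n%:R * eps + 1) / m%:R))%R.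
    by field; rewrite !gt_eqF.
  rewrite (@le_trans _ _ (n%:R^-1 * - ln a)%R)// ?ler_pM2l ?invr_gt0 ?lerN2//.
  by rewrite ler_peMr ?ler_pdivlMr ?mul1r// mulr_ge0 ?invr_ge0 ?oppr_ge0// ltW.
have -> : (n%:R^-1 * - ln p + ln n%:R / n%:R = n%:R^-1 * (ln n%:R - ln p))%R by ring.
apply: (@le_trans _ _ (n%:R^-1 * - ln a)%R); last first.
  by rewrite ler_pM2l ?invr_gt0// lerBrDr addrC lerBlDr.
by rewrite mulrA ler_wpM2r ?oppr_ge0// ler_pdivrMr// mulrC ler_pdivlMr// mulrC ltW.
Qed.

Theorem theorem4p1 (R : realType) (chi : pointedType)
    (chi_countable : countable [set: chi])
    (mu nu : probability (seqspace chi) R)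
    (mu_stationary : stationary mu) (nu_stationary : stationary nu)
    (eps : R) (eps_gt0 : (0 < eps)%R) (eps_lt1 : (eps < 1)%R) :
  (eps%:E * lower_rate mu nu <= lower_Delta mu nu eps /\
   upper_Delta mu nu eps <= eps%:E * upper_rate mu nu) /\
  (complete_grammar nu ->
   lower_Delta mu nu eps = eps%:E * lower_rate mu nu /\
   upper_Delta mu nu eps = eps%:E * upper_rate mu nu).
Proof.
pose w n := eps%:E * divergence_rate mu nu (match_length eps n).
have bounds : \forall n \near \oo,
    deviation_rate mu nu eps n <= (1 + (n%:R * eps)^-1)%:E * w n /\
    w n <= deviation_rate mu nu eps n + (ln n%:R / n%:R)%:E.
  apply: filterS (match_length_near_lt eps_gt0 eps_lt1) => n mn.
  have n0 : (0 < n)%N by apply: leq_ltn_trans mn.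
  apply: log_rate_bounds => //.
  - exact: match_length_bounds.
  - exact: divergence_ge0.
  - exact: divergence_le_product.
  - exact: product_le_divergence.
  - by apply: probability_le1; exact: measurable_lower_deviation_event.
have dev_ge0 n : 0 <= deviation_rate mu nu eps n.
  by rewrite mule_ge0 ?lee_fin ?invr_ge0.
have w_ge0 n : 0 <= w n.
  rewrite !mule_ge0 ?lee_fin ?invr_ge0// ?(ltW eps_gt0)//.
  by rewrite oppe_ge0 lne_le0 divergence_le1.
(* The factor error 1/(n eps) is at most r once n >= 1/(r eps); the additive r is slack. *)
have dev_le_w r : (0 < r)%R ->
    \forall n \near \oo, deviation_rate mu nu eps n <= (1 + r)%:E * w n + r%:E.
  move=> r0; near=> n.
  have n0 : (0 < n%:R :> R)%R by rewrite ltr0n; near: n; exact: nbhs_infty_gt.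
  have [+ _] : deviation_rate mu nu eps n <= (1 + (n%:R * eps)^-1)%:E * w n /\
    w n <= deviation_rate mu nu eps n + (ln n%:R / n%:R)%:E by near: n.
  move=> /le_trans; apply; rewrite (@le_trans _ _ ((1 + r)%:E * w n))//.
    rewrite lee_wpmul2r// lee_fin lerD2l invf_ple ?posrE ?mulr_gt0//.
    by rewrite -ler_pdivrMr//; near: n; exact: nbhs_infty_ger.
  by rewrite leeDl// lee_fin ltW.
(* Here the additive error ln n / n is eventually at most r, and the factor 1 + r is slack. *)
have w_le_dev r : (0 < r)%R ->
    \forall n \near \oo, w n <= (1 + r)%:E * deviation_rate mu nu eps n + r%:E.
  move=> r0; near=> n.
  have n0 : (0 < n%:R :> R)%R by rewrite ltr0n; near: n; exact: nbhs_infty_gt.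
  have [_ +] : deviation_rate mu nu eps n <= (1 + (n%:R * eps)^-1)%:E * w n /\
    w n <= deviation_rate mu nu eps n + (ln n%:R / n%:R)%:E by near: n.
  move=> /le_trans; apply; rewrite leeD//.
    by rewrite lee_pemull// lee_fin lerDl ltW.
  by rewrite lee_fin ler_pdivrMr// mulrC; near: n; exact: ln_sublinear_near.
have m_oo := match_length_infty eps_gt0.
have m_surj := match_length_surj eps_gt0 eps_lt1.
(* Scaling and reindexing turn the right side into the limit inferior of [w]; perturbation in both
   directions equates it with that of [deviation_rate]. *)
have lowerE : lower_Delta mu nu eps = eps%:E * lower_rate mu nu.
  rewrite -limn_einfZ// -(limn_einf_subsequence _ m_oo m_surj).
  by apply/eqP; rewrite eq_le !limn_einf_perturb.
have upperE : upper_Delta mu nu eps = eps%:E * upper_rate mu nu.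
  rewrite -limn_esupZ// -(limn_esup_subsequence _ m_oo m_surj).
  by apply/eqP; rewrite eq_le !limn_esup_perturb.
by rewrite lowerE upperE.
Unshelve. all: by end_near. Qed.
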